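(* Let $f$ be $\rho$-weakly convex and $r$ be $\eta$-weakly convex on $\mathbb{X}$ with $\rho,\eta\ge0$, and let $\{x^k\}$ be generated by Prox-SubGrad for $\min_{x\in\mathbb{X}}\varphi(x)=f(x)+r(x)$. Suppose that (i) or (ii) holds: (i) $\varphi$ satisfies the global quadratic growth property with constant $\kappa_{gQG}^{\varphi}>0$, i.e. $\mathrm{dist}^2(x,\mathbb{X}^* )\le\kappa_{gQG}^{\varphi}[\varphi(x)-\varphi^*]$ for all $x\in\mathbb{X}$, and one of the following holds: (1) $\kappa_{gQG}^{\varphi}<\frac{2}{\rho+2\eta}$, condition (B$_{\text{A-D}}$) holds with $c_{10}=0$, and the step size is constant, $\alpha_k=\alpha\in\Big(0,\min\Big\{\frac{2-\kappa_{gQG}^{\varphi}(\rho+2\eta)}{2c_9^2\kappa_{gQG}^{\varphi}},\frac{1}{6\eta}\Big\}\Big)$. (2) $\kappa_{gQG}^{\varphi}<\frac{2}{\rho+2\eta}$, condition (B$_{\text{G}}$) holds with $c_{12}=0$, and the step size is constant, $\alpha_k=\alpha\in\Big(0,\min\Big\{\frac{2-\kappa_{gQG}^{\varphi}(\rho+2\eta)}{2c_{11}(\rho+\eta+c_{11})\kappa_{gQG}^{\varphi}},\frac{1}{6\eta}\Big\}\Big)$. (3) $\kappa_{gQG}^{\varphi}<\frac1\rho$, $\eta=0$, the step sizes are $\alpha_k=\frac{\varphi(x^k)-\varphi^*}{2\|g(x^k)+h(x^k)\|^2}$ with $h(x^k)\in\partial r(x^k)$, $\varphi$ satisfies the $\mathcal{T}_\gamma$-sharpness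 condition with constant $\kappa_s^\varphi>0$ for some $\gamma>0$, and (B$_6$) holds on the tube $\{x\in\mathbb{X}\mid\mathrm{dist}(x,\mathbb{X}^* )<\mathrm{dist}(x^0,\mathbb{X}^* )+1\}$. (ii) $\eta=0$, $\varphi$ satisfies the $\mathcal{T}_\gamma$-sharpness condition with constant $\kappa_s^\varphi>0$ for some $0<\gamma<\frac{1}{\rho\kappa_s^\varphi}$, (B$_6$) holds on $\mathcal{T}_\gamma$, the initial point satisfies $x^0\in\mathcal{T}_\gamma$, and the step sizes are $\alpha_k=\frac{\varphi(x^k)-\varphi^*}{2\|g(x^k)+h(x^k)\|^2}$ with $h(x^k)\in\partial r(x^k)$. Then there exists $0<\mu<1$ such that $$\mathrm{dist}^2(x^{k+1},\mathbb{X}^* )\le\mu\,\mathrm{dist}^2(x^k,\mathbb{X}^* )\qquad\text{for all }k=0,1,2,\dots$$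
   Context: Setting: $\mathbb{X}\subseteq\mathbb{R}^d$ is closed and convex; $f,r:\mathbb{X}\to\mathbb{R}$ are proper and lower semicontinuous; $\varphi=f+r$; the set $\mathbb{X}^*$ of minimizers of $\varphi$ over $\mathbb{X}$ is non-empty and $\varphi^*$ is the minimum value. A function $u:\mathbb{X}\to\mathbb{R}$ is $\rho$-weakly convex if $\theta=u+\frac{\rho}{2}\|\cdot\|^2$ is convex; then $\partial u(x)=\partial\theta(x)-\rho x$, where $\partial\theta(x)=\{v:\theta(y)\ge\theta(x)+\langle v,y-x\rangle\ \forall y\in\mathbb{X}\}$. Prox-SubGrad: starting from $x^0\in\mathbb{X}$, for $k=0,1,\dots$ pick $g(x^k)\in\partial f(x^k)$ and a step size $\alpha_k$, and set $x^{k+1}=\arg\min_{x\in\mathbb{X}}\langle g(x^k),x\rangle+r(x)+\frac{1}{2\alpha_k}\|x-x^k\|^2$. For the step sizes $\alpha_k=\frac{\varphi(x^k)-\varphi^*}{2\|g(x^k)+h(x^k)\|^2}$, if $\varphi(x^k)=\varphi^*$ then $\alpha_k=0$ and $x^{k+1}=x^k$. Conditions (for all $g(x)\in\partial f(x)$, $h(x)\in\partial r(x)$): (B$_{\text{A-D}}$) there are $c_9,c_{10}\ge0$ with $\|g(x)+h(x)\|\le c_9\,\mathrm{dist}(x,\mathbb{X}^* )+c_{10}$ for all $x\in\mathbb{X}$; (B$_{\text{G}}$) there are $c_{11},c_{12}\ge0$ with $\|g(x)+h(x)\|\le\sqrt{c_{11}[\varphi(x)-\varphi^*]+c_{12}}$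 for all $x\in\mathbb{X}$; (B$_6$) on a set $S$: there is $c_8>0$ with $\|g(x)+h(x)\|\le c_8$ for all $x\in S$. $\mathcal{T}_\gamma=\{x\in\mathbb{X}\mid\mathrm{dist}(x,\mathbb{X}^* )<\gamma\}$. $\mathcal{T}_\gamma$-sharpness with constant $\kappa_s^\varphi>0$: $\mathrm{dist}(x,\mathbb{X}^* )\le\kappa_s^\varphi[\varphi(x)-\varphi^*]$ for all $x\in\mathcal{T}_\gamma$. Convention: a fraction with positive numerator and zero denominator equals $+\infty$. *)

(* Defs.v *)
From HB Require Import structures.
From mathcomp Require Import all_boot all_order all_algebra.
From mathcomp Require Import all_classical all_reals all_analysis.
Import Order.TTheory GRing.Theory Num.Theory numFieldNormedType.Exports.

Set Implicit Arguments.
Unset Strict Implicit.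
Unset Printing Implicit Defensive.

Local Open Scope classical_set_scope.
Local Open Scope ring_scope.

(* The library norm of 'rV[R]_d is the sup norm, so the Euclidean inner product
   and norm are introduced here; both norms induce the same topology. *)
Definition dot (R : realType) (d : nat) (u v : 'rV[R]_d) : R :=
  \sum_(i < d) u ord0 i * v ord0 i.

Definition enorm (R : realType) (d : nat) (u : 'rV[R]_d) : R :=
  Num.sqrt (dot u u).

Definition dist (R : realType) (d : nat) (x : 'rV[R]_d) (A : set 'rV[R]_d) : R :=
  inf [set enorm (x - y) | y in A].

(* Functions X -> R are represented by total functions 'rV[R]_d -> R; all the
   notions below depend only on their values on X. *)

Definition argmin_on (R : realType) (d : nat) (X : set 'rV[R]_d)
    (u : 'rV[R]_d -> R) : set 'rV[R]_d :=
  [set x | X x /\ forall y, X y -> u x <= u y].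

Definition minval (R : realType) (d : nat) (X : set 'rV[R]_d)
    (u : 'rV[R]_d -> R) : R :=
  inf [set u x | x in X].

(* Points outside X are isolated in [subspace X], so this is lower
   semicontinuity of the restriction of u to X. *)
Definition lsc_on (R : realType) (d : nat) (X : set 'rV[R]_d)
    (u : 'rV[R]_d -> R) : Prop :=
  lower_semicontinuous (fun x : subspace X => (u x)%:E).

Definition add_quad (R : realType) (d : nat) (rho : R)
    (u : 'rV[R]_d -> R) : 'rV[R]_d -> R :=
  fun x => u x + rho / 2 * enorm x ^+ 2.

Definition weakly_convex (R : realType) (d : nat) (X : set 'rV[R]_d) (rho : R)
    (u : 'rV[R]_d -> R) : Prop :=
  convex_function X (add_quad rho u).

Definition convex_subdiff (R : realType) (d : nat) (X : set 'rV[R]_d)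
    (theta : 'rV[R]_d -> R) (x : 'rV[R]_d) : set 'rV[R]_d :=
  [set v | forall y, X y -> theta x + dot v (y - x) <= theta y].

Definition subdiff (R : realType) (d : nat) (X : set 'rV[R]_d) (rho : R)
    (u : 'rV[R]_d -> R) (x : 'rV[R]_d) : set 'rV[R]_d :=
  [set v - rho *: x | v in convex_subdiff X (add_quad rho u) x].

(* In \bar R, 0^-1 = +oo and 0 * +oo = 0. Hence xfrac a 0 = +oo for a > 0, and
   xfrac 0 b = 0 for every b, including b = 0. *)
Definition xfrac (R : realType) (a b : R) : \bar R := (a%:E / b%:E)%E.

(* The step size is extended-real, as the Polyak-type quotient may a priori have
   a zero denominator; for a = +oo the quadratic term has weight 0. *)
Definition prox_subgrad_step (R : realType) (d : nat) (X : set 'rV[R]_d)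
    (r : 'rV[R]_d -> R) (g : 'rV[R]_d) (a : \bar R) (x x' : 'rV[R]_d) : Prop :=
  if a == 0%E then x' = x
  else argmin_on X
    (fun y => dot g y + r y + fine ((2%:E * a)^-1)%E * enorm (y - x) ^+ 2) x'.

Definition prox_subgrad (R : realType) (d : nat) (X : set 'rV[R]_d) (rho : R)
    (f r : 'rV[R]_d -> R) (x g : nat -> 'rV[R]_d) (alpha : nat -> \bar R) : Prop :=
  X (x 0%N) /\
  forall k, subdiff X rho f (x k) (g k) /\
            prox_subgrad_step X r (g k) (alpha k) (x k) (x k.+1).

Definition polyak_steps (R : realType) (d : nat) (X : set 'rV[R]_d)
    (eta : R) (f r : 'rV[R]_d -> R) (x g : nat -> 'rV[R]_d)
    (alpha : nat -> \bar R) : Prop :=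
  let phi := f \+ r in
  exists h : nat -> 'rV[R]_d, forall k, subdiff X eta r (x k) (h k) /\
    alpha k = xfrac (phi (x k) - minval X phi) (2 * enorm (g k + h k) ^+ 2).

(* [b x] bounds the norm of every g + h, where g and h range over the
   subdifferentials of f and r at x, for all x in S. *)
Definition subgrads_bounded (R : realType) (d : nat) (X : set 'rV[R]_d)
    (rho eta : R) (f r : 'rV[R]_d -> R) (S : set 'rV[R]_d)
    (b : 'rV[R]_d -> R) : Prop :=
  forall x g h, S x -> subdiff X rho f x g -> subdiff X eta r x h ->
    enorm (g + h) <= b x.

Definition cond_BAD (R : realType) (d : nat) (X : set 'rV[R]_d) (rho eta : R)
    (f r : 'rV[R]_d -> R) (c9 c10 : R) : Prop :=
  [/\ 0 <= c9, 0 <= c10 & subgrads_bounded X rho eta f r X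
    (fun x => c9 * dist x (argmin_on X (f \+ r)) + c10)].

Definition cond_BG (R : realType) (d : nat) (X : set 'rV[R]_d) (rho eta : R)
    (f r : 'rV[R]_d -> R) (c11 c12 : R) : Prop :=
  let phi := f \+ r in
  [/\ 0 <= c11, 0 <= c12 & subgrads_bounded X rho eta f r X
    (fun x => Num.sqrt (c11 * (phi x - minval X phi) + c12))].

Definition cond_B6 (R : realType) (d : nat) (X : set 'rV[R]_d) (rho eta : R)
    (f r : 'rV[R]_d -> R) (S : set 'rV[R]_d) : Prop :=
  exists2 c8 : R, 0 < c8 & subgrads_bounded X rho eta f r S (fun=> c8).

Definition tube (R : realType) (d : nat) (X : set 'rV[R]_d)
    (phi : 'rV[R]_d -> R) (gamma : R) : set 'rV[R]_d :=
  [set x | X x /\ dist x (argmin_on X phi) < gamma].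

Definition sharp_on_tube (R : realType) (d : nat) (X : set 'rV[R]_d)
    (phi : 'rV[R]_d -> R) (gamma kappa : R) : Prop :=
  forall x, tube X phi gamma x ->
    dist x (argmin_on X phi) <= kappa * (phi x - minval X phi).

Definition global_quadratic_growth (R : realType) (d : nat) (X : set 'rV[R]_d)
    (phi : 'rV[R]_d -> R) (kappa : R) : Prop :=
  forall x, X x ->
    dist x (argmin_on X phi) ^+ 2 <= kappa * (phi x - minval X phi).

(* Main.v *)
(* The first-order condition of the proximal subproblem, combined with weak
   convexity of f and r, gives for every minimizer p and h in dr(x^k)
     (1 - a eta) |x^{k+1} - p|^2 <= (1 + a rho) |x^k - p|^2
       - 2 a (phi(x^k) - phi^* ) + a^2 |g + h|^2 / (1 - a eta),
   and the growth, sharpness and subgradient bounds turn this into a contraction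
   of the squared distance to the set of minimizers.

   For constant steps the bounds only say something at x^k if dr(x^k) is
   nonempty. For k >= 1 this follows from the optimality of x^k in its own
   subproblem. At k = 0 it has to be derived: the bound forces x^1 into the
   interior of X (elsewhere subdifferentials absorb a nontrivial normal cone), so
   both subdifferentials are nonempty on the segment from x^1 towards x^0; there
   the subgradients of f are bounded by monotonicity against g(x^0), hence those
   of r are bounded as well and cluster at an element of dr(x^0). *)
Require Import Defs.
From mathcomp Require Import all_boot all_order all_algebra.
From mathcomp Require Import all_classical all_reals all_analysis.
From mathcomp Require Import ring lra.
Import Order.TTheory GRing.Theory Num.Theory numFieldNormedType.Exports.

Local Open Scope classical_set_scope.
Local Open Scope ring_scope.

Set Implicit Arguments.
Unset Strict Implicit.
Unset Printing Implicit Defensive.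

(** * Euclidean inner product and distance *)

Section InnerProduct.
Context {R : realType} {d : nat}.
Implicit Types u v w x y : 'rV[R]_d.

Lemma dotC u v : dot u v = dot v u.
Proof. by apply: eq_bigr => i _; rewrite mulrC. Qed.

Lemma dotDl u v w : dot (u + v) w = dot u w + dot v w.
Proof. by rewrite -big_split; apply: eq_bigr => i _; rewrite mxE mulrDl. Qed.

Lemma dotZl a u w : dot (a *: u) w = a * dot u w.
Proof. by rewrite /dot mulr_sumr; apply: eq_bigr => i _; rewrite mxE mulrA. Qed.

Lemma dotNl u w : dot (- u) w = - dot u w.
Proof. by rewrite -scaleN1r dotZl mulN1r. Qed.

Lemma dotDr u v w : dot w (u + v) = dot w u + dot w v.
Proof. by rewrite !(dotC w) dotDl. Qed.

Lemma dotZr a u w : dot w (a *: u) = a * dot w u.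
Proof. by rewrite !(dotC w) dotZl. Qed.

Lemma dotNr u w : dot w (- u) = - dot w u.
Proof. by rewrite !(dotC w) dotNl. Qed.

Definition dotE := (dotDl, dotDr, dotNl, dotNr, dotZl, dotZr).

Lemma dot_ge0 u : 0 <= dot u u.
Proof. by apply: sumr_ge0 => i _; rewrite -expr2 sqr_ge0. Qed.

Lemma coord_sqr_le_dot u i : u ord0 i ^+ 2 <= dot u u.
Proof.
rewrite /dot (bigD1 i)//= expr2 lerDl.
by apply: sumr_ge0 => j _; rewrite -expr2 sqr_ge0.
Qed.

Lemma enorm_sqr u : enorm u ^+ 2 = dot u u.
Proof. by rewrite sqr_sqrtr// dot_ge0. Qed.

Lemma enorm_ge0 u : 0 <= enorm u.
Proof. exact: sqrtr_ge0. Qed.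

Lemma cauchy_schwarz u v : dot u v <= enorm u * enorm v.
Proof.
apply: (le_trans (ler_norm _)); rewrite -sqrtr_sqr /enorm -sqrtrM ?dot_ge0//.
apply: ler_wsqrtr.
have := dot_ge0 v; rewrite le_eqVlt => /predU1P[v0|v0].
  suff -> : dot u v = 0 by rewrite expr0n /= -v0 mulr0.
  rewrite /dot big1// => i _; suff -> : v ord0 i = 0 by rewrite mulr0.
  apply/eqP; rewrite -sqrf_eq0 eq_le sqr_ge0 andbT.
  by rewrite v0 coord_sqr_le_dot.
have := dot_ge0 (dot v v *: u - dot u v *: v).
rewrite !dotE (dotC v u) => h.
have {h} : 0 <= dot v v * (dot u u * dot v v - dot u v ^+ 2).
  by apply: (le_trans h); rewrite le_eqVlt; apply/orP; left; apply/eqP; ring.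
by rewrite pmulr_rge0// subr_ge0.
Qed.

End InnerProduct.

Section Distance.
Context {R : realType} {d : nat}.
Implicit Types (x y p : 'rV[R]_d) (A : set 'rV[R]_d).

Lemma dist_has_inf x A : A !=set0 -> has_inf [set enorm (x - y) | y in A].
Proof.
move=> [p Ap]; split; first by exists (enorm (x - p)), p.
by exists 0 => _ [y _ <-]; exact: enorm_ge0.
Qed.

Lemma dist_ge0 x A : A !=set0 -> 0 <= dist x A.
Proof.
move=> A0; have [ne _] := dist_has_inf x A0.
by apply: lb_le_inf => // _ [y _ <-]; exact: enorm_ge0.
Qed.

Lemma dist_le x A p : A p -> dist x A <= enorm (x - p).
Proof.
move=> Ap; have A0 : A !=set0 by exists p.
by apply: ge_inf; [case: (dist_has_inf x A0) | exists p].
Qed.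

(** Attainment of the infimum is avoided: for [s <= 1], a point of [A] within [dist x A + s] of [x]
    raises the squared distance by at most [s * (2 * dist x A + 1)], and [s] is taken so small that
    [b] times this stays below [e]. *)
Lemma le_dist_sqr x A (a b c : R) : A !=set0 -> 0 <= b ->
  (forall p, A p -> a <= b * enorm (x - p) ^+ 2 + c) -> a <= b * dist x A ^+ 2 + c.
Proof.
move=> A0 b0 H; apply/ler_addgt0Pr => e e0.
have D0 := dist_ge0 x A0.
have den : 0 < b * (2 * dist x A + 1) + 1 by nra.
pose s := Num.min 1 (e / (b * (2 * dist x A + 1) + 1)).
have s0 : 0 < s by rewrite lt_min ltr01 divr_gt0.
have s1 : s <= 1 by rewrite ge_min lexx.
have se : s * (b * (2 * dist x A + 1) + 1) <= e.
  by rewrite -ler_pdivlMr// ge_min lexx orbT.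
have [_ [p Ap <-] ps] := inf_adherent s0 (dist_has_inf x A0).
rewrite -/(dist x A) in ps.
have := H p Ap; have := enorm_ge0 (x - p) => P0 HP.
have : enorm (x - p) ^+ 2 <= dist x A ^+ 2 + s * (2 * dist x A + 1) by nra.
by move/(ler_wpM2l b0); nra.
Qed.

End Distance.

(** * Weak convexity and the proximal step *)

Section WeakConvexity.
Context {R : realType} {d : nat}.
Implicit Types (X : set 'rV[R]_d) (u : 'rV[R]_d -> R) (x y w g : 'rV[R]_d).

Lemma convex_set_segment X x y (t : R) : convex_set X -> X x -> X y ->
  0 <= t <= 1 -> X (x + t *: (y - x)).
Proof.
move=> cX Xx Xy /andP[t0 t1].
have := cX y x (Itv01 t0 t1); rewrite !inE => /(_ Xy Xx) /=.
suff <- : conv (Itv01 t0 t1) (y : convex_lmodType 'rV[R]_d) x =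
  x + t *: (y - x) by [].
by rewrite /conv/= /unstable.onem scalerBr scalerBl scale1r addrCA addrA.
Qed.

Lemma weakly_convex_segment X rho u x y (t : R) : weakly_convex X rho u ->
  X x -> X y -> 0 <= t <= 1 ->
  u (x + t *: (y - x)) <= (1 - t) * u x + t * u y +
    rho / 2 * (t * (1 - t)) * enorm (y - x) ^+ 2.
Proof.
move=> wu Xx Xy /andP[t0 t1].
have := wu (Itv01 t0 t1) y x; rewrite !inE => /(_ Xy Xx).
have -> : conv (Itv01 t0 t1) (y : convex_lmodType 'rV[R]_d) x =
  x + t *: (y - x).
  by rewrite /conv/= /unstable.onem scalerBr scalerBl scale1r addrCA addrA.
rewrite convRE /= /unstable.onem /add_quad !enorm_sqr !dotE (dotC y x).
by nra.
Qed.

(** Expanding the square of [y = x + (y - x)] absorbs the shift by [rho *: x]. A subgradient is then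
    the slope at [x] of a quadratic of curvature [- rho] that supports [u] from below; later
    arguments use this form. *)
Lemma subdiffP X rho u x w :
  subdiff X rho u x w <->
  forall y, X y -> u x + dot w (y - x) - rho / 2 * enorm (y - x) ^+ 2 <= u y.
Proof.
split=> [[v Hv <-] y /Hv|H].
  by rewrite /add_quad !enorm_sqr !dotE (dotC y x); lra.
exists (w + rho *: x); last by rewrite addrK.
by move=> y /H; rewrite /add_quad !enorm_sqr !dotE (dotC y x); lra.
Qed.

(** Fermat's rule, without a sum rule: [y] is compared with [y + t *: (z - y)], weak convexity
    bounds [u] there, and after division by [t] only [A] survives as [t] tends to 0. *)
Lemma subdiff_argmin X rho u g x y (q : R) : convex_set X ->
  weakly_convex X rho u ->
  argmin_on X (fun z => dot g z + u z + q * enorm (z - x) ^+ 2) y ->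
  subdiff X rho u y (- (g + (2 * q) *: (y - x))).
Proof.
move=> cX wu [Xy miny]; apply/subdiffP => z Xz.
set N := enorm (z - y) ^+ 2.
have N0 : 0 <= N by rewrite sqr_ge0.
set A := u z - u y + rho / 2 * N + dot (g + (2 * q) *: (y - x)) (z - y).
suff : 0 <= A by rewrite /A dotNl; lra.
have key (t : R) : 0 < t <= 1 -> 0 <= A + t * (q * N - rho / 2 * N).
  move=> /andP[t0 t1].
  have t01 : 0 <= t <= 1 by rewrite ltW.
  have wc := weakly_convex_segment wu Xy Xz t01.
  have := miny _ (convex_set_segment cX Xy Xz t01).
  rewrite -/N in wc *.
  have eqq : enorm (y + t *: (z - y) - x) ^+ 2 =
    enorm (y - x) ^+ 2 + 2 * t * dot (y - x) (z - y) + t ^+ 2 * N.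
    rewrite /N !enorm_sqr !dotE (dotC y x) (dotC z y) (dotC z x); ring.
  rewrite eqq dotDr dotZr => hm.
  rewrite -(pmulr_rge0 _ t0) /A dotDl dotZl; nra.
rewrite leNgt; apply/negP => A0.
set B := q * N - rho / 2 * N in key.
have B0 : 0 < `|B| - A by rewrite subr_gt0 (lt_le_trans A0).
(* An explicit [t] replaces the limit: it is at most 1/2, and t (|B| - A) = -A/2 makes A + t B
   negative when A < 0. *)
have := key (- A / (2 * (`|B| - A))).
have t0 : 0 < - A / (2 * (`|B| - A)) by rewrite divr_gt0 ?mulr_gt0 ?oppr_gt0.
rewrite t0 /= ler_pdivrMr ?mulr_gt0// => h.
have /h : - A <= 1 * (2 * (`|B| - A)) by have := normr_ge0 B; lra.
have tE : - A / (2 * (`|B| - A)) * (`|B| - A) = - A / 2.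
  by field; rewrite gt_eqF.
move: t0 tE; move: (- A / (2 * _)) => t t0 tE hB.
have h1 : t * B <= t * `|B| by apply: ler_wpM2l; [exact: ltW | exact: ler_norm].
have h2 : t * A < 0 by rewrite pmulr_rlt0.
by rewrite mulrBr in tE; lra.
Qed.

End WeakConvexity.

(** * The proximal step and its descent inequality *)

Section ProximalStep.
Context {R : realType} {d : nat}.
Implicit Types (X : set 'rV[R]_d) (f r : 'rV[R]_d -> R) (x p g h : 'rV[R]_d).

Lemma prox_step_argmin X r g (a : R) x x' : 0 < a ->
  prox_subgrad_step X r g a%:E x x' ->
  argmin_on X (fun y => dot g y + r y + (2 * a)^-1 * enorm (y - x) ^+ 2) x'.
Proof.
by move=> a0; rewrite /prox_subgrad_step eqe (gt_eqF a0) -EFinM fine_invr.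
Qed.

Lemma prox_step_subdiff X eta r g (a : R) x x' : convex_set X ->
  weakly_convex X eta r -> 0 < a -> prox_subgrad_step X r g a%:E x x' ->
  subdiff X eta r x' (- (g + a^-1 *: (x' - x))).
Proof.
move=> cX wr a0 /(prox_step_argmin a0) /(subdiff_argmin cX wr).
suff -> : 2 * (2 * a)^-1 = a^-1 by [].
by field; rewrite gt_eqF.
Qed.

(** Sum of three subgradient inequalities: [g] at [x] tested at [p], [h] at [x] tested at [x'], and
    the optimality subgradient of [r] at [x'] tested at [p]. *)
Lemma prox_step_descent X rho eta f r g h (a : R) x x' p : convex_set X ->
  weakly_convex X eta r -> 0 < a -> a * eta < 1 -> X x -> X p ->
  subdiff X rho f x g -> subdiff X eta r x h ->
  prox_subgrad_step X r g a%:E x x' ->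
  (1 - a * eta) * enorm (x' - p) ^+ 2 <=
  (1 + a * rho) * enorm (x - p) ^+ 2 +
  (a ^+ 2 / (1 - a * eta) * enorm (g + h) ^+ 2 -
   2 * a * ((f \+ r) x - (f \+ r) p)).
Proof.
move=> cX wr a0 aeta Xx Xp /subdiffP Hg /subdiffP Hh st.
have [Xx' _] := prox_step_argmin a0 st.
have /subdiffP Hs := prox_step_subdiff cX wr a0 st.
have := Hg _ Xp; have := Hh _ Xx'; have := Hs _ Xp.
rewrite /= !enorm_sqr.
have c0 : 0 < 1 - a * eta by rewrite subr_gt0.
set c := 1 - a * eta in c0 *.
(* Young's inequality with weight [c]: the cross term of [g + h] with [x' - x] is absorbed by the
   [c] times squared step length left over in the sum. *)
have sq (s v : 'rV[R]_d) :
    0 <= c * dot s s + 2 * a * dot v s + a ^+ 2 / c * dot v v.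
  have := dot_ge0 (c *: s + a *: v); rewrite !dotE (dotC s v) => h1.
  rewrite -(pmulr_rge0 _ c0); apply: (le_trans h1).
  rewrite le_eqVlt; apply/orP; left; apply/eqP.
  by field; rewrite gt_eqF.
move: {sq}(sq (x' - x) (g + h)) => sq.
set S := dot (x' - x) (x' - x) in sq *.
have eS : S = dot x' x' - 2 * dot x x' + dot x x.
  by rewrite /S !dotE (dotC x' x); ring.
have eP : dot (p - x) (p - x) = dot (x - p) (x - p).
  by rewrite -opprB dotNl dotNr opprK.
have eP' : dot (p - x') (p - x') = dot (x' - p) (x' - p).
  by rewrite -opprB dotNl dotNr opprK.
rewrite eP eP'; set P := dot (x - p) (x - p); set P' := dot (x' - p) (x' - p).
have id3 : dot (x' - x) (p - x') = (P - P' - S) / 2.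
  by rewrite /P /P' /S !dotE (dotC x' x) (dotC p x) (dotC x' p); field.
rewrite (dotNl (g + _)) (dotDl g (_ *: _)) dotZl id3.
have id4 : dot g (p - x) - dot g (p - x') = dot g (x' - x).
  by rewrite !dotE; ring.
move: sq id4; rewrite !(dotDl g h).
set W := _ + dot h (g + h).
move: (dot g (p - x)) (dot g (p - x')) (dot g (x' - x)) (dot h (x' - x)) => A B C D.
move=> sq id4 h1 h2 h3; rewrite -{}id4 in sq.
have {}h1 : a * (r x' + - (B + a^-1 * ((P - P' - S) / 2)) - eta / 2 * P') <= a * r p.
  by rewrite ler_pM2l.
have {}h2 : a * (r x + D - eta / 2 * S) <= a * r x' by rewrite ler_pM2l.
have {}h3 : a * (f x + A - rho / 2 * P) <= a * f p by rewrite ler_pM2l.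
have e1 : a * (r x' + - (B + a^-1 * ((P - P' - S) / 2)) - eta / 2 * P') =
  a * r x' - a * B - (P - P' - S) / 2 - a * eta / 2 * P'.
  by field; rewrite gt_eqF.
rewrite e1 in h1.
by rewrite /c in sq *; lra.
Qed.

(** An upper bound on the gap, opposite to growth: it excludes [g + h = 0] for Polyak steps and
    turns (B_G) into a bound by the distance. *)
Lemma weakly_convex_gap X rho eta f r g h x p :
  X p -> subdiff X rho f x g -> subdiff X eta r x h ->
  (f \+ r) x - (f \+ r) p <=
  enorm (g + h) * enorm (x - p) + (rho + eta) / 2 * enorm (x - p) ^+ 2.
Proof.
move=> Xp /subdiffP Hg /subdiffP Hh.
have := Hg _ Xp; have := Hh _ Xp; have := cauchy_schwarz (g + h) (x - p).
have -> : enorm (p - x) = enorm (x - p).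
  by rewrite /enorm -opprB dotNl dotNr opprK.
by rewrite -(opprB x p) !dotNr dotDl /=; lra.
Qed.

End ProximalStep.

(** * Linear rates *)

Section LinearConvergence.
Context {R : realType} {d : nat}.
Implicit Types (X : set 'rV[R]_d) (f r phi : 'rV[R]_d -> R).

Lemma minval_argmin X phi p : argmin_on X phi p -> minval X phi = phi p.
Proof.
move=> [Xp minp]; apply/eqP; rewrite eq_le; apply/andP; split.
  by apply: ge_inf; [exists (phi p) => _ [y Xy <-]; exact: minp | exists p].
by apply: lb_le_inf; [exists (phi p), p | move=> _ [y Xy <-]; exact: minp].
Qed.

Lemma minval_le X phi y : argmin_on X phi !=set0 -> X y -> minval X phi <= phi y.
Proof. by move=> [p Ap] Xy; rewrite (minval_argmin Ap); apply Ap.2. Qed.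

Lemma dist_sqr_step X rho eta f r (g h : 'rV[R]_d) (a : R) (x x' : 'rV[R]_d) :
  let phi := f \+ r in let S := argmin_on X phi in
  convex_set X -> S !=set0 -> 0 <= rho -> weakly_convex X eta r ->
  0 < a -> a * eta < 1 -> X x ->
  subdiff X rho f x g -> subdiff X eta r x h ->
  prox_subgrad_step X r g a%:E x x' ->
  (1 - a * eta) * dist x' S ^+ 2 <=
  (1 + a * rho) * dist x S ^+ 2 +
  (a ^+ 2 / (1 - a * eta) * enorm (g + h) ^+ 2 - 2 * a * (phi x - minval X phi)).
Proof.
move=> phi S cX S0 rho0 wr a0 aeta Xx Hg Hh st.
apply: le_dist_sqr => //; first by nra.
move=> p Sp; rewrite (minval_argmin Sp).
apply: le_trans (prox_step_descent cX wr a0 aeta Xx Sp.1 Hg Hh st).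
rewrite ler_wpM2l ?subr_ge0 ?(ltW aeta)//.
by rewrite ler_sqr ?nnegrE ?dist_ge0 ?enorm_ge0// dist_le.
Qed.

Lemma prox_subgrad_feasible X rho f r (x g : nat -> 'rV[R]_d) (a : nat -> \bar R) k :
  prox_subgrad X rho f r x g a -> X (x k).
Proof.
move=> [X0 st]; elim: k => // k IH; have [_] := st k; rewrite /prox_subgrad_step.
by case: ifP => [_ ->//|_ []].
Qed.

(** Quadratic growth bounds the gap below by the squared distance over [kappa], so one step
    contracts by [M / c]; the step size bounds give [M < c]. *)
Lemma constant_step_linear_rate X rho eta f r (x g : nat -> 'rV[R]_d) alpha
    (kappa a C : R) :
  let phi := f \+ r in let S := argmin_on X phi in
  convex_set X -> S !=set0 -> 0 <= rho -> 0 <= eta -> weakly_convex X eta r ->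
  prox_subgrad X rho f r x g alpha -> (forall k, alpha k = a%:E) ->
  0 < kappa -> global_quadratic_growth X phi kappa -> 0 <= C ->
  kappa * (rho + 2 * eta) < 2 -> 0 < a ->
  a * (2 * C * kappa) < 2 - kappa * (rho + 2 * eta) -> a * (6 * eta) < 1 ->
  (forall k, exists2 h, subdiff X eta r (x k) h &
     enorm (g k + h) ^+ 2 <= C * dist (x k) S ^+ 2) ->
  exists mu : R, [/\ 0 < mu, mu < 1 &
    forall k, dist (x k.+1) S ^+ 2 <= mu * dist (x k) S ^+ 2].
Proof.
move=> phi S cX S0 rho0 eta0 wr pr alphaE k0 qg C0 k2 a0 aC a6 Hh.
set c := 1 - a * eta.
have c56 : 5 / 6 <= c by rewrite /c; lra.
have c0 : 0 < c by lra.
pose M := 1 + a * rho + a ^+ 2 / c * C - 2 * a / kappa.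
have Mc : M < c.
  (* The restriction [a * (6 * eta) < 1] enters here: division by [c] costs at most a factor 6/5. *)
  have ck : a * C * kappa / c <= 6 / 5 * (a * C * kappa).
    rewrite ler_pdivrMr//; have : 0 <= a * C * kappa.
      by rewrite !mulr_ge0 ?(ltW a0) ?(ltW k0).
    by nra.
  have ke : 0 <= kappa * eta by rewrite mulr_ge0// ltW.
  have neg : kappa * (rho + eta) - 2 + a * C * kappa / c < 0 by lra.
  have : a / kappa * (kappa * (rho + eta) - 2 + a * C * kappa / c) < 0.
    by rewrite pmulr_rlt0 ?divr_gt0.
  have -> : a / kappa * (kappa * (rho + eta) - 2 + a * C * kappa / c) =
    a * rho + a * eta + a ^+ 2 / c * C - 2 * a / kappa.
    by field; rewrite !gt_eqF.
  by move=> neg2; have cE : c = 1 - a * eta by []; rewrite /M [X in _ < X]cE; lra.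
(* The maximum with 1/2 keeps the rate positive, as the sign of [M] is not known. *)
exists (Num.max (1 / 2) (M / c)); split.
- by rewrite lt_max; apply/orP; left; lra.
- by rewrite gt_max; apply/andP; split; [lra | rewrite ltr_pdivrMr// mul1r].
move=> k; have [h Hk hC] := Hh k.
have Xk := prox_subgrad_feasible k pr.
have [Hg] := pr.2 k; rewrite alphaE => st.
have aeta : a * eta < 1 by rewrite -subr_gt0.
have step := dist_sqr_step cX S0 rho0 wr a0 aeta Xk Hg Hk st.
rewrite -/c -/phi -/S in step.
have D0 : 0 <= dist (x k) S ^+ 2 by rewrite sqr_ge0.
have gap := qg _ Xk; rewrite -/S in gap.
have : c * dist (x k.+1) S ^+ 2 <= M * dist (x k) S ^+ 2.
  have e1 : a ^+ 2 / c * enorm (g k + h) ^+ 2 <= a ^+ 2 / c * (C * dist (x k) S ^+ 2).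
    by rewrite ler_wpM2l// divr_ge0 ?sqr_ge0 ?ltW.
  have e2 : 2 * a / kappa * dist (x k) S ^+ 2 <= 2 * a * (phi (x k) - minval X phi).
    rewrite mulrAC ler_pdivrMr//.
    have -> : 2 * a * (phi (x k) - minval X phi) * kappa =
      2 * a * (kappa * (phi (x k) - minval X phi)) by ring.
    by rewrite ler_pM2l ?mulr_gt0.
  by rewrite /M; lra.
rewrite mulrC -ler_pdivlMr// => /le_trans; apply.
rewrite mulrAC ler_wpM2r// le_max lexx orbT //.
Qed.

(** Common to both Polyak cases; [L] is the radius of a tube on which all bounds hold. With gap
    [Delta] and step [a], the descent terms sum to [-3/2 * a * Delta]; weak convexity costs at most
    [a * Delta], and the remaining half gives the contraction. *)
Lemma polyak_linear_rate X rho f r (x g h : nat -> 'rV[R]_d) alpha (L K c8 : R) :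
  let phi := f \+ r in let S := argmin_on X phi in
  convex_set X -> S !=set0 -> 0 <= rho -> weakly_convex X 0 r ->
  prox_subgrad X rho f r x g alpha ->
  (forall k, subdiff X 0 r (x k) (h k) /\
    alpha k = xfrac (phi (x k) - minval X phi) (2 * enorm (g k + h k) ^+ 2)) ->
  0 < K -> 0 < c8 -> dist (x 0%N) S < L ->
  (forall y u v, tube X phi L y -> subdiff X rho f y u -> subdiff X 0 r y v ->
     enorm (u + v) <= c8) ->
  (forall y, tube X phi L y -> rho * dist y S ^+ 2 <= phi y - minval X phi) ->
  (forall y, tube X phi L y -> dist y S <= K * (phi y - minval X phi)) ->
  exists mu : R, [/\ 0 < mu, mu < 1 &
    forall k, dist (x k.+1) S ^+ 2 <= mu * dist (x k) S ^+ 2].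
Proof.
move=> phi S cX S0 rho0 wr pr Hh K0 c80 x0L bnd weak sharp.
(* The gain a Delta / 2 equals Delta^2 / (4 V^2), where V <= [c8] and Delta is at least the distance
   over [K]. *)
pose q : R := 1 / (4 * c8 ^+ 2 * K ^+ 2).
have q0 : 0 < q by rewrite divr_gt0 ?ltr01 ?mulr_gt0 ?exprn_gt0.
have step k : dist (x k) S < L ->
    dist (x k.+1) S ^+ 2 <= (1 - q) * dist (x k) S ^+ 2.
  move=> xkL; have Xk := prox_subgrad_feasible k pr.
  have tk : tube X phi L (x k) by [].
  have [Hg st] := pr.2 k; have [Hk ak] := Hh k.
  have D0 : 0 <= dist (x k) S by exact: dist_ge0.
  have := weak _ tk; have := sharp _ tk; have := bnd _ _ _ tk Hg Hk.
  have : 0 <= phi (x k) - minval X phi by rewrite subr_ge0 minval_le.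
  have gap p : S p -> phi (x k) - minval X phi <= enorm (g k + h k) * enorm (x k - p) +
      rho / 2 * enorm (x k - p) ^+ 2.
    move=> Sp; rewrite (minval_argmin Sp).
    by have := weakly_convex_gap Sp.1 Hg Hk; rewrite addr0.
  set Delta := phi (x k) - minval X phi in ak gap *.
  rewrite le_eqVlt => /predU1P[De|Dpos] b1 b2 b3.
    (* Zero gap: the quotient is 0 whatever its denominator, so the iterate stays put, already at
       distance 0. *)
    have dk0 : dist (x k) S = 0.
      by apply/eqP; rewrite eq_le D0 andbT (le_trans b2)// -De mulr0.
    move: st; rewrite ak -De /xfrac mul0e /prox_subgrad_step eqxx => ->.
    by rewrite dk0 expr0n/= mulr0.
  (* A zero sum would give Delta <= rho/2 dist^2 <= Delta/2, against Delta > 0; hence the step size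
     is finite. *)
  have v0 : 0 < enorm (g k + h k).
    rewrite lt_neqAle enorm_ge0 andbT eq_sym; apply/eqP => v0.
    have : Delta <= rho / 2 * dist (x k) S ^+ 2 + 0.
      apply: le_dist_sqr => //; first by lra.
      by move=> p /gap; rewrite v0 mul0r add0r addr0.
    by lra.
  set V := enorm (g k + h k) in ak v0 b1.
  have V2 : 0 < V ^+ 2 by rewrite exprn_gt0.
  have aE : alpha k = (Delta / (2 * V ^+ 2))%:E.
    by rewrite ak /xfrac inver gt_eqF ?mulr_gt0// -EFinM.
  rewrite aE in st.
  have a0 : 0 < Delta / (2 * V ^+ 2) by rewrite divr_gt0 ?mulr_gt0.
  have aeta : Delta / (2 * V ^+ 2) * 0 < 1 by rewrite mulr0 ltr01.
  have := dist_sqr_step cX S0 rho0 wr a0 aeta Xk Hg Hk st.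
  rewrite -/phi -/S -/Delta -/V mulr0 subr0 mul1r divr1.
  set a := Delta / (2 * V ^+ 2) in a0 *.
  have aV : a ^+ 2 * V ^+ 2 = a * Delta / 2 by rewrite /a; field; rewrite gt_eqF.
  rewrite {}aV => h1.
  have h2 : a * (rho * dist (x k) S ^+ 2) <= a * Delta by rewrite ler_pM2l.
  have h3 : q * dist (x k) S ^+ 2 <= a * Delta / 2.
    have -> : a * Delta / 2 = Delta ^+ 2 / (4 * V ^+ 2).
      by rewrite /a; field; rewrite gt_eqF.
    have s1 : dist (x k) S ^+ 2 <= K ^+ 2 * Delta ^+ 2.
      by rewrite -exprMn ler_sqr ?nnegrE// mulr_ge0 ?ltW.
    have s2 : V ^+ 2 <= c8 ^+ 2 by rewrite ler_sqr ?nnegrE ?(ltW v0) ?(ltW c80).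
    rewrite ler_pdivlMr ?mulr_gt0// /q mul1r -[_^-1 * _ * _]mulrA mulrC.
    rewrite ler_pdivrMr ?mulr_gt0 ?exprn_gt0//.
    have := ler_pM (sqr_ge0 _) (ltW V2) s1 s2; lra.
  by lra.
(* The distances do not increase, so the iterates never leave the tube. *)
have inL k : dist (x k) S < L.
  elim: k => // k IH; apply: le_lt_trans (IH).
  rewrite -ler_sqr ?nnegrE ?dist_ge0// (le_trans (step k IH))//.
  by rewrite ler_piMl ?sqr_ge0// gerBl ltW.
exists (Num.max (1 / 2) (1 - q)); split.
- by rewrite lt_max; apply/orP; left; lra.
- by rewrite gt_max; apply/andP; split; lra.
move=> k; apply: (le_trans (step k (inL k))).
by rewrite ler_wpM2r ?sqr_ge0// le_max lexx orbT.
Qed.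

End LinearConvergence.

(** * Lower semicontinuity and compactness *)

Section EuclideanTopology.
Context {R : realType} {d : nat}.
Implicit Types (x y z v w : 'rV[R]_d) (A : set 'rV[R]_d).

Lemma dot_le_coord v (M : R) : (forall i, `|v ord0 i| <= M) ->
  dot v v <= d%:R * M ^+ 2.
Proof.
move=> vM; rewrite mulr_natl -[d in leRHS]card_ord -sumr_const; apply: ler_sum => i _.
by rewrite -expr2 -real_normK ?num_real// lerXn2r ?nnegrE ?(le_trans _ (vM i)).
Qed.

Lemma normr_le_enorm v : `|v| <= enorm v.
Proof.
rewrite /Num.norm/= mx_normrE; apply/bigmax_leP.
split=> [|[i j] _]; first exact: enorm_ge0.
rewrite /= ord1 -ler_sqr ?nnegrE ?enorm_ge0// real_normK ?num_real//.
by rewrite enorm_sqr coord_sqr_le_dot.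
Qed.

Lemma cvg_dot {T : Type} (F : set_system T) (v w : T -> 'rV[R]_d) (a b : 'rV[R]_d) :
  Filter F -> v @ F --> a -> w @ F --> b ->
  (fun t => dot (v t) (w t)) @ F --> dot a b.
Proof.
move=> FF va wb; rewrite /dot; apply: cvg_big => [|i _]; first exact: add_continuous.
have coord (u : T -> 'rV[R]_d) (c : 'rV[R]_d) : u @ F --> c ->
    (fun t => u t ord0 i) @ F --> c ord0 i.
  pose coordi (M : 'rV[R]_d) := M ord0 i.
  move=> uc; apply: (@cvg_comp _ _ _ u coordi F (nbhs c) _ uc).
  exact: coord_continuous.
by apply: cvgM; exact: coord.
Qed.

Lemma cvg_enorm_sub {T : Type} (F : set_system T) (v : T -> 'rV[R]_d) (a x : 'rV[R]_d) :
  Filter F -> v @ F --> a ->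
  (fun t => enorm (v t - x) ^+ 2) @ F --> enorm (a - x) ^+ 2.
Proof.
move=> FF va; under eq_cvg do rewrite enorm_sqr; rewrite enorm_sqr.
have h : (fun t => v t - x) @ F --> a - x by apply: cvgB => //; exact: cvg_cst.
exact: cvg_dot.
Qed.

Lemma continuous_enorm_sub x : continuous (fun y => enorm (y - x) ^+ 2).
Proof. by move=> y; apply: (@cvg_enorm_sub _ (nbhs y) id y x _); exact: cvg_id. Qed.

Lemma enorm0 : enorm (0 : 'rV[R]_d) = 0.
Proof. by rewrite /enorm -(scale0r 0) dotZl mul0r sqrtr0. Qed.

Lemma nbhs_enormP x A :
  nbhs x A <-> exists2 s : R, 0 < s & forall y, enorm (y - x) <= s -> A y.
Proof.
split=> [/nbhs_normP[s /= s0 sA]|[s s0 sA]].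
  exists (s / 2) => [|y ys]; first by rewrite divr_gt0.
  apply: sA => /=; rewrite distrC (le_lt_trans (normr_le_enorm _))//.
  by rewrite (le_lt_trans ys)// ltr_pdivrMr// ltr_pMr// ltr1n.
have : (fun y => enorm (y - x) ^+ 2) @ x --> enorm (x - x) ^+ 2.
  by exact: continuous_enorm_sub.
rewrite subrr enorm0 expr0n/= => /cvgr_lt /(_ (s ^+ 2)).
rewrite exprn_gt0// => /(_ isT); apply: filterS => y.
rewrite ltr_sqr ?nnegrE ?enorm_ge0 ?(ltW s0)//.
by move/ltW/sA.
Qed.

Lemma cvg_enorm_rate (y : nat -> 'rV[R]_d) x (C : R) :
  (forall n, enorm (y n - x) ^+ 2 <= C / n.+1%:R) -> y @ \oo --> x.
Proof.
move=> yC; move=> A /nbhs_enormP[s s0 sA].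
have e0 : 0 < s ^+ 2 / (`|C| + 1) by rewrite divr_gt0 ?exprn_gt0 ?ltr_wpDl.
have := @near_infty_natSinv_lt R (PosNum e0); apply: filterS => n /= /ltW hn.
apply: sA; rewrite -ler_sqr ?nnegrE ?enorm_ge0 ?(ltW s0)// (le_trans (yC n))//.
move: hn; rewrite ler_pdivlMr ?ltr_wpDl//.
have : 0 <= n.+1%:R^-1 :> R by rewrite invr_ge0.
move: (n.+1%:R^-1) => t t0 ht; have := ler_wpM2r t0 (ler_norm C).
by rewrite mulrDr mulr1 (mulrC t) in ht; lra.
Qed.

Lemma eball_compact x (s : R) : compact [set y | enorm (y - x) ^+ 2 <= s].
Proof.
apply: bounded_closed_compact.
  exists (`|x| + (s + 1)); split; first exact: num_real.
  move=> M xM y /= ys; apply: le_trans (ltW xM).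
  rewrite -[y](subrK x) addrC (le_trans (ler_normD _ _))// lerD2l.
  rewrite (le_trans (normr_le_enorm _))//.
  by have := enorm_ge0 (y - x); nra.
have -> : [set y | enorm (y - x) ^+ 2 <= s] =
  (fun y => enorm (y - x) ^+ 2) @^-1` [set t | t <= s] by [].
apply: preimage_closed; last exact: closed_le.
by move=> y _; exact: continuous_enorm_sub.
Qed.

Lemma eball_convex x (s : R) : convex_set [set y | enorm (y - x) ^+ 2 <= s].
Proof.
move=> y z l; rewrite !inE /= => ys zs.
have -> : conv l (y : convex_lmodType 'rV[R]_d) z = l%:num *: y + (1 - l%:num) *: z.
  by rewrite /conv.
have l0 : 0 <= l%:num by exact: ge0. have l1 : l%:num <= 1 by exact: le1.
move: (l%:num) l0 l1 => t t0 t1.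
have e : enorm (t *: y + (1 - t) *: z - x) ^+ 2 = t * enorm (y - x) ^+ 2 +
   (1 - t) * enorm (z - x) ^+ 2 - t * (1 - t) * enorm (y - z) ^+ 2.
  by rewrite !enorm_sqr !dotE (dotC z y) (dotC x y) (dotC x z); ring.
have := sqr_ge0 (enorm (y - z)); rewrite e => h.
have h1 : 0 <= t * (1 - t) * enorm (y - z) ^+ 2.
  by apply: mulr_ge0 h; apply: mulr_ge0; rewrite ?subr_ge0.
by nra.
Qed.

(** Stands in for extracting a subsequence: the image of an ultrafilter is an ultrafilter, hence
    converges in a compact ball. *)
Lemma cvg_ultra_bounded (U : set_system nat) (v : nat -> 'rV[R]_d) (C : R) :
  UltraFilter U -> (forall n, enorm (v n) ^+ 2 <= C) -> exists l : 'rV[R]_d, v @ U --> l.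
Proof.
move=> UU vC; have := @eball_compact 0 C; rewrite compact_ultra => /(_ (v @ U)).
have vU : UltraFilter (v @ U).
  split=> [|G GG sub]; first exact: fmap_proper_filter.
  apply/seteqP; split=> [A GA|]; last exact: sub.
  have [//|UA] := in_ultra_setVsetC (v @^-1` A) UU.
  have GcA : G (~` A) by apply: sub.
  by have [t [At /(_ At)]] := filter_ex (@filterI _ G _ _ _ GA GcA).
move=> /(_ vU) [|l [_ vl]]; last by exists l.
by apply: nearW => n; rewrite /= subr0.
Qed.

End EuclideanTopology.

(** * Attainment of minima and closedness of subdifferentials *)

Section LowerSemicontinuity.
Context {R : realType} {d : nat}.
Implicit Types (X K : set 'rV[R]_d) (u : 'rV[R]_d -> R) (x : 'rV[R]_d).

Lemma lsc_onP X u : lsc_on X u <->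
  forall x (e : R), X x -> 0 < e -> \forall y \near x, X y -> u x - e < u y.
Proof.
split=> [lu x e Xx e0|H x a].
  have [|V] := lu x (u x - e); first by rewrite lte_fin ltrBlDr ltrDl.
  move=> nV Vu; have : within X (nbhs x) V by rewrite nbhs_subspace_in.
  rewrite /within/=.
  by apply: filterS => y + Xy => /(_ Xy)/Vu; rewrite lte_fin.
rewrite lte_fin => aux; have [Xx|nXx] := pselect (X x).
  have e0 : 0 < u x - a by rewrite subr_gt0.
  exists [set y | X y /\ a < u y]; last by move=> y [_]; rewrite lte_fin.
  suff : within X (nbhs (x : 'rV[R]_d)) [set y | X y /\ a < u y].
    by rewrite nbhs_subspace_in.
  rewrite /within/=; have := H x _ Xx e0.
  by apply: filterS => y + Xy => /(_ Xy); rewrite subKr.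
exists [set x]; last by move=> y ->; rewrite lte_fin.
by apply: open_nbhs_nbhs; split=> //; exact: open_subspace1out.
Qed.

Lemma lsc_onS X K u : K `<=` X -> lsc_on X u -> lsc_on K u.
Proof.
move=> KX /lsc_onP lu; apply/lsc_onP => x e Kx e0.
by apply: filterS (lu x e (KX _ Kx) e0) => y h /KX.
Qed.

Lemma lsc_on_cst X (c : R) : lsc_on X (fun=> c).
Proof.
by apply/lsc_onP => x e _ e0; apply: filterS (@filterT _ (nbhs x) _) => y _ _;
  rewrite ltrBlDr ltrDl.
Qed.

Lemma lsc_on_prox X u (g x : 'rV[R]_d) (q : R) : lsc_on X u ->
  lsc_on X (fun y => dot g y + u y + q * enorm (y - x) ^+ 2).
Proof.
move=> /lsc_onP lu; apply/lsc_onP => y e Xy e0.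
have e2 : 0 < e / 2 by rewrite divr_gt0.
have c : (fun z => dot g z + q * enorm (z - x) ^+ 2) @ y -->
    dot g y + q * enorm (y - x) ^+ 2.
  have c1 : (fun z => dot g z) @ y --> dot g y.
    by apply: (@cvg_dot _ _ _ (nbhs y) (cst g) id g y _);
      [exact: cvg_cst | exact: cvg_id].
  have c2 : (fun z => q * enorm (z - x) ^+ 2) @ y --> q * enorm (y - x) ^+ 2.
    by apply: (@cvgM _ _ (nbhs y) _ (cst q));
      [exact: cvg_cst | exact: continuous_enorm_sub].
  exact: cvgD c1 c2.
have := cvgr_gt _ c (dot g y + q * enorm (y - x) ^+ 2 - e / 2).
rewrite ltrBlDr ltrDl => /(_ _ e2); apply: filterS2 (lu y (e / 2) Xy e2).
by move=> z Hz h Xz; have := Hz Xz; lra.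
Qed.

(** The sublevel sets [B z] generate a proper filter on [K]; by lower semicontinuity a cluster point
    lies below every value. *)
Lemma argmin_on_compact K u : compact K -> K !=set0 -> lsc_on K u ->
  argmin_on K u !=set0.
Proof.
move=> cK [z0 Kz0] /lsc_onP lu.
pose B z := [set y | K y /\ u y <= u z].
have FB : Filter (filter_from K B).
  apply: filter_from_filter; first by exists z0.
  move=> i j Ki Kj; have [uij|uji] := leP (u i) (u j).
    by exists i => // y [Ky yi]; split; split=> //; exact: le_trans uij.
  by exists j => // y [Ky yj]; split; split=> //; exact: le_trans (ltW uji).
have PB : ProperFilter (filter_from K B).
  by apply: filter_from_proper => i Ki; exists i; split.
have BK : filter_from K B K by exists z0 => // y [].
have [y [Ky cly]] := cK _ PB BK.
exists y; split=> // z Kz; apply/ler_addgt0Pr => e e0.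
have Bz : filter_from K B (B z) by exists z.
have [w [[Kw wz] /(_ Kw) yw]] := cly _ _ Bz (lu y e Ky e0).
by lra.
Qed.

(** In the support inequality at a fixed [z], only [u (y t)] may fail to converge, and lower
    semicontinuity bounds it from below by nearly [u x]. *)
Lemma subdiff_cvg {T : Type} (F : set_system T) X rho u
    (y v : T -> 'rV[R]_d) x w : ProperFilter F -> lsc_on X u -> X x ->
  (forall t, X (y t)) -> (forall t, subdiff X rho u (y t) (v t)) ->
  y @ F --> x -> v @ F --> w -> subdiff X rho u x w.
Proof.
move=> FF /lsc_onP lu Xx Xy vy yx vw; apply/subdiffP => z Xz.
apply/ler_addgt0Pr => e e0.
pose G t := u z - dot (v t) (z - y t) + rho / 2 * enorm (y t - z) ^+ 2.
have Gc : G @ F --> u z - dot w (z - x) + rho / 2 * enorm (x - z) ^+ 2.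
  apply: cvgD; last by apply: cvgZr; exact: cvg_enorm_sub.
  apply: cvgB; first exact: cvg_cst.
  by apply: cvg_dot => //; apply: cvgB => //; exact: cvg_cst.
have esym (a b : 'rV[R]_d) : enorm (a - b) = enorm (b - a).
  by rewrite /enorm -opprB dotNl dotNr opprK.
suff : u x - e <= u z - dot w (z - x) + rho / 2 * enorm (x - z) ^+ 2.
  by rewrite (esym z x); lra.
apply: (@cvgr_to_ge _ F FF R G _ _ Gc).
apply: (@filterS _ F _ _ _ _ (yx _ (lu x e Xx e0))) => t /= /(_ (Xy t)) h.
have /subdiffP /(_ z Xz) := vy t; rewrite /G (esym z); lra.
Qed.

End LowerSemicontinuity.

(** * Existence of subgradients *)

Section Subdifferentiability.
Context {R : realType} {d : nat}.
Implicit Types (X K : set 'rV[R]_d) (u f r : 'rV[R]_d -> R) (x y z v : 'rV[R]_d).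

Lemma enorm_subC x y : enorm (x - y) = enorm (y - x).
Proof. by rewrite /enorm -opprB dotNl dotNr opprK. Qed.

Lemma enormD_sqr_le x y : enorm (x + y) ^+ 2 <= 2 * enorm x ^+ 2 + 2 * enorm y ^+ 2.
Proof.
by have := dot_ge0 (x - y); rewrite !enorm_sqr !dotE (dotC y x); lra.
Qed.

Lemma enormZ_sqr (a : R) x : enorm (a *: x) ^+ 2 = a ^+ 2 * enorm x ^+ 2.
Proof. by rewrite !enorm_sqr !dotE; ring. Qed.

Lemma dot_delta v i : dot v (delta_mx ord0 i) = v ord0 i.
Proof.
rewrite /dot (bigD1 i)//= mxE !eqxx mulr1 big1 ?addr0// => j ji.
by rewrite mxE (negbTE ji) andbF mulr0.
Qed.

Lemma enorm_delta (i : 'I_d) : enorm (delta_mx ord0 i : 'rV[R]_d) ^+ 2 = 1.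
Proof. by rewrite enorm_sqr dot_delta mxE !eqxx. Qed.

Lemma convex_setI X K : convex_set X -> convex_set K -> convex_set (X `&` K).
Proof.
move=> cX cK y z l; rewrite !inE => -[Xy Ky] [Xz Kz].
have := cX y z l; have := cK y z l; rewrite !inE => /(_ Ky Kz) + /(_ Xy Xz).
by split.
Qed.

Lemma weakly_convexS X K rho u : K `<=` X -> weakly_convex X rho u ->
  weakly_convex K rho u.
Proof.
by move=> KX wu t y z; rewrite !inE => /KX Xy /KX Xz; apply: wu; rewrite inE.
Qed.

(** The support inequality at a nearby point of the segment from [x] to [y] extends to [y] by weak
    convexity: the quadratic errors, with factors [t ^+ 2] and [t * (1 - t)], add up to exactly
    [t]. *)
Lemma subdiff_local X K rho u x v : convex_set X -> weakly_convex X rho u ->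
  X x -> (\forall y \near x, X y -> K y) -> subdiff K rho u x v ->
  subdiff X rho u x v.
Proof.
move=> cX wu Xx /nbhs_enormP[s s0 sK] /subdiffP Hv; apply/subdiffP => y Xy.
set N := enorm (y - x).
have N0 : 0 <= N := enorm_ge0 _.
pose t := Num.min 1 (s / (N + 1)).
have t0 : 0 < t by rewrite lt_min ltr01 divr_gt0// ltr_wpDl.
have t1 : t <= 1 by rewrite ge_min lexx.
have t01 : 0 <= t <= 1 by rewrite (ltW t0).
have ts : t * (N + 1) <= s by rewrite -ler_pdivlMr ?ltr_wpDl// ge_min lexx orbT.
have Xt := convex_set_segment cX Xx Xy t01.
have eN : enorm (x + t *: (y - x) - x) ^+ 2 = t ^+ 2 * N ^+ 2.
  by rewrite addrC addKr enormZ_sqr.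
have : K (x + t *: (y - x)).
  apply: sK => //; rewrite -ler_sqr ?nnegrE ?enorm_ge0 ?(ltW s0)// eN -exprMn.
  by rewrite ler_sqr ?nnegrE ?mulr_ge0 ?(ltW t0) ?(ltW s0)//; lra.
move=> /Hv; rewrite eN; have := weakly_convex_segment wu Xx Xy t01.
rewrite -/N [x + _ - x]addrC addKr dotZr => h1 h2.
by rewrite -(ler_pM2l t0); nra.
Qed.

(* The proximal points of x converge to x; their subgradients stay bounded,
   because x is interior, and cluster at a subgradient at x. *)
Lemma subdiff_interior X rho u x : convex_set X -> 0 <= rho ->
  weakly_convex X rho u -> lsc_on X u -> nbhs x X ->
  subdiff X rho u x !=set0.
Proof.
move=> cX rho0 wu lu /[dup] nX /nbhs_enormP[s s0 sX].
pose K := [set y | enorm (y - x) ^+ 2 <= s ^+ 2].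
have KX : K `<=` X.
  by move=> y; rewrite /K/= ler_sqr ?nnegrE ?enorm_ge0 ?(ltW s0)// => /sX.
have Kx : K x by rewrite /K/= subrr enorm0 expr0n/= sqr_ge0.
have cK : convex_set K by apply: eball_convex.
have kK : compact K by exact: eball_compact.
have lK : lsc_on K u := lsc_onS KX lu.
have wK : weakly_convex K rho u := weakly_convexS KX wu.
have K0 : K !=set0 by exists x.
have [m [Km minm]] := argmin_on_compact kK K0 lK.
have /choice[y Hy] (n : nat) : exists y, argmin_on K
    (fun y => dot 0 y + u y + n.+1%:R * enorm (y - x) ^+ 2) y.
  by apply: (argmin_on_compact kK K0); exact: lsc_on_prox.
pose v n := - (0 + (2 * n.+1%:R) *: (y n - x)).
have vy n : subdiff K rho u (y n) (v n) := subdiff_argmin cK wK (Hy n).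
have dot0l z : dot 0 z = 0 by rewrite -(scale0r z) dotZl mul0r.
pose C := u x - u m.
have C0 : 0 <= C by rewrite subr_ge0; exact: minm.
have yC n : enorm (y n - x) ^+ 2 <= C / n.+1%:R.
  have [Kyn /(_ x Kx)] := Hy n.
  rewrite !dot0l subrr enorm0 expr0n/= mulr0 ler_pdivlMr// /C.
  by have := minm _ Kyn; lra.
have yC1 n : enorm (y n - x) ^+ 2 <= C.
  apply: (le_trans (yC n)); rewrite ler_pdivrMr//.
  by rewrite ler_peMr// ler1n.
pose B i := `|u (x + s *: delta_mx ord0 i)| + `|u (x - s *: delta_mx ord0 i)|.
(* Testing [v n] at the points at distance [s] from [x] along the coordinate axes bounds each of its
   coordinates by [M]. *)
pose M := (\sum_i B i + `|u m| + rho * (s ^+ 2 + C)) / s.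
have BM i : B i <= \sum_j B j.
  by rewrite (bigD1 i)//= lerDl sumr_ge0// => j _; rewrite addr_ge0.
have vM n i : `|v n ord0 i| <= M.
  have probe (b : R) : b ^+ 2 = 1 -> b * s * v n ord0 i <=
      u (x + (b * s) *: delta_mx ord0 i) - u m + rho * (s ^+ 2 + C).
    move=> b1; set z := x + _.
    have ez : enorm (z - x) ^+ 2 = s ^+ 2.
      by rewrite /z addrC addKr enormZ_sqr enorm_delta exprMn b1 mulr1 mul1r.
    have Kz : K z by rewrite /K/= ez.
    have /subdiffP /(_ z Kz) := vy n.
    have e2 : enorm (z - y n) ^+ 2 <= 2 * s ^+ 2 + 2 * C.
      have := enormD_sqr_le (z - x) (x - y n); rewrite subrKA ez => h.
      by have := yC1 n; rewrite enorm_subC; lra.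
    have {e2} : rho * enorm (z - y n) ^+ 2 <= rho * (2 * s ^+ 2 + 2 * C).
      by rewrite ler_wpM2l.
    (* The part of [z - y n] along [x - y n] contributes nonnegatively, since [v n] is a positive
       multiple of [x - y n]. *)
    have e3 : b * s * v n ord0 i <= dot (v n) (z - y n).
      have -> : z - y n = (b * s) *: delta_mx ord0 i + (x - y n).
        by rewrite /z [x + _]addrC -addrA.
      rewrite dotDr dotZr dot_delta lerDl /v add0r -scalerN opprB dotZl.
      by rewrite mulr_ge0// dot_ge0.
    by have := minm _ (Hy n).1; lra.
  have pp := probe 1 (expr1n _ _).
  have pm : (-1) ^+ 2 = 1 :> R by rewrite sqrrN expr1n.
  have {probe}pm := probe _ pm; rewrite mulN1r scaleNr !mul1r in pp pm.
  have BMi := BM i; rewrite /B in BMi.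
  have l1 := ler_norm (u (x + s *: delta_mx ord0 i)).
  have l2 := ler_norm (u (x - s *: delta_mx ord0 i)).
  have l3 := ler_norm (- u m); rewrite normrN in l3.
  have l1' := normr_ge0 (u (x + s *: delta_mx ord0 i)).
  have l2' := normr_ge0 (u (x - s *: delta_mx ord0 i)).
  by rewrite ler_norml lerNl /M !ler_pdivlMr//; apply/andP; split; lra.
have [U [UU sU]] := ultraFilterLemma eventually_filter.
have vC n : enorm (v n) ^+ 2 <= d%:R * M ^+ 2.
  by rewrite enorm_sqr; exact: dot_le_coord.
have [l vl] := cvg_ultra_bounded UU vC.
exists l; apply: (subdiff_local cX wu (KX _ Kx)) (_ : subdiff K rho u x l).
  apply/nbhs_enormP; exists s => // z zs _.
  by rewrite /K/= ler_sqr ?nnegrE ?enorm_ge0 ?(ltW s0).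
apply: (@subdiff_cvg _ _ _ U K rho u y v x l) => //; first by move=> n; apply (Hy n).1.
exact: (cvg_trans (cvg_app y sU) (cvg_enorm_rate yC)).
Qed.

(** Points [z n] outside [X] approach [x]; the unit vectors from their projections [p n] on [K] to
    [z n] are normal to [K] and cluster at the required normal. Normals are treated as subgradients
    of the zero function, so closedness and locality of subdifferentials apply. *)
Lemma normal_vector X x : closed X -> convex_set X -> X x -> ~ nbhs x X ->
  exists2 v, enorm v = 1 & forall y, X y -> dot v (y - x) <= 0.
Proof.
move=> clX cX Xx nX.
have w0 (K : set 'rV[R]_d) : weakly_convex K 0 (fun=> 0 : R).
  move=> t y z _ _; rewrite /add_quad convRE !(mul0r, addr0, mulr0); lra.
have /choice[z Hz] (n : nat) : exists z, enorm (z - x) <= n.+1%:R^-1 /\ ~ X z.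
  apply: contrapT => H; apply: nX; apply/nbhs_enormP; exists n.+1%:R^-1 => // z zn.
  by apply: contrapT => Xz; apply: H; exists z.
pose K := X `&` [set y | enorm (y - x) ^+ 2 <= 1].
have cK : convex_set K by apply: convex_setI => //; exact: eball_convex.
have kK : compact K.
  by rewrite /K setIC; apply: compact_closedI => //; exact: eball_compact.
have Kx : K x by split=> //=; rewrite subrr enorm0 expr0n/= ler01.
have /choice[p Hp] (n : nat) : exists p, argmin_on K
    (fun y => dot 0 y + 0 + 1 * enorm (y - z n) ^+ 2) p.
  apply: (argmin_on_compact kK); first by exists x.
  by apply: (@lsc_on_prox _ _ K (fun=> 0)); exact: lsc_on_cst.
have dot0l y : dot 0 y = 0 by rewrite -(scale0r y) dotZl mul0r.
have zp n : 0 < enorm (z n - p n).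
  rewrite lt_neqAle enorm_ge0 andbT eq_sym; apply/eqP => e.
  apply: (Hz n).2; suff -> : z n = p n by exact: (Hp n).1.1.
  apply/eqP; rewrite -subr_eq0 -normr_le0 -e; exact: normr_le_enorm.
pose v n := (enorm (z n - p n))^-1 *: (z n - p n).
have vp n : subdiff K 0 (fun=> 0) (p n) (v n).
  have /subdiffP H := subdiff_argmin cK (w0 K) (Hp n).
  apply/subdiffP => y /H; rewrite !mul0r !add0r !subr0 mulr1 -scalerN opprB !dotZl => h.
  rewrite mulr_ge0_le0 ?invr_ge0 ?enorm_ge0//; lra.
have v1 n : enorm (v n) ^+ 2 = 1.
  by rewrite enormZ_sqr exprVn mulVf// gt_eqF// exprn_gt0.
have px n : enorm (p n - x) ^+ 2 <= 4 / n.+1%:R.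
  have := (Hp n).2 x Kx; rewrite !dot0l !add0r !mul1r => h.
  have h2 := enormD_sqr_le (p n - z n) (z n - x); rewrite subrKA in h2.
  rewrite (enorm_subC x) in h.
  have := (Hz n).1; have := enorm_ge0 (z n - x).
  have : 0 <= n.+1%:R^-1 :> R by rewrite invr_ge0.
  have : n.+1%:R^-1 <= 1 :> R by rewrite invf_le1 ?ler1n.
  move: (n.+1%:R^-1) => t t1 t0 e0 et; have : enorm (z n - x) ^+ 2 <= t by nra.
  by lra.
have [U [UU sU]] := ultraFilterLemma eventually_filter.
have v1' n : enorm (v n) ^+ 2 <= 1 by rewrite v1.
have [l vl] := cvg_ultra_bounded UU v1'.
have l1 : enorm l ^+ 2 = 1.
  have h := @cvg_enorm_sub _ _ _ U v l 0 _ vl.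
  have v1E : (fun n => enorm (v n - 0) ^+ 2) = cst (1 : R).
    by apply/funext => n; rewrite subr0 v1.
  rewrite v1E subr0 in h; apply: (cvg_unique (@Rhausdorff R) (h _)).
  exact: cvg_cst.
exists l; first by apply/eqP; rewrite -(@eqrXn2 _ 2) ?enorm_ge0// l1 expr1n.
suff /subdiffP H : subdiff X 0 (fun=> 0) x l.
  by move=> y /H; rewrite !mul0r subr0 add0r.
apply: (subdiff_local cX (w0 X) Xx) (_ : subdiff K _ _ _ _).
  by apply/nbhs_enormP; exists 1 => // y y1 Xy; split=> //=; rewrite expr_le1 ?enorm_ge0.
apply: (@subdiff_cvg _ _ _ U K 0 _ p v x l) => //; first exact: lsc_on_cst.
  by move=> n; exact: (Hp n).1.
exact: (cvg_trans (cvg_app p sU) (cvg_enorm_rate px)).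
Qed.

End Subdifferentiability.

(** * Subgradients of [r] from bounded sums *)

Section BoundedSums.
Context {R : realType} {d : nat}.
Implicit Types (X : set 'rV[R]_d) (f r : 'rV[R]_d -> R) (x y z v : 'rV[R]_d).

(* At a boundary point the subdifferential absorbs the normal cone, so the
   sums [g + h] there would be unbounded. *)
Lemma bounded_sums_interior X rho eta f r x g h (B : R) : closed X ->
  convex_set X -> X x -> subdiff X rho f x g -> subdiff X eta r x h ->
  (forall g', subdiff X rho f x g' -> enorm (g' + h) <= B) -> nbhs x X.
Proof.
move=> clX cX Xx /subdiffP Hg Hh HB; apply: contrapT => nX.
have [v v1 Hv] := normal_vector clX cX Xx nX.
have B0 : 0 <= B := le_trans (enorm_ge0 _) (HB _ ((subdiffP _ _ _ _ _).2 Hg)).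
(* Shifting [g] by [s *: v] and bounding the sums by [B] would give [s ^+ 2 <= s - 1], impossible
   for [s >= 1]. *)
pose s := 2 * B ^+ 2 + 2 * enorm (g + h) ^+ 2 + 1.
have s1 : 1 <= s by have := sqr_ge0 B; have := sqr_ge0 (enorm (g + h)); rewrite /s; lra.
have Hgs : subdiff X rho f x (g + s *: v).
  apply/subdiffP => y Xy; have := Hg _ Xy; have := Hv _ Xy.
  rewrite dotDl dotZl; nra.
have := HB _ Hgs; have := enorm_ge0 (g + s *: v + h).
have := enormD_sqr_le (g + s *: v + h) (- (g + h)).
have -> : g + s *: v + h - (g + h) = s *: v.
  by rewrite opprD addrACA subrr addr0 addrAC subrr add0r.
rewrite enormZ_sqr v1 expr1n mulr1 -sub0r enorm_subC subr0 => h1 h2 h3.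
have : enorm (g + s *: v + h) ^+ 2 <= B ^+ 2.
  by rewrite ler_sqr ?nnegrE.
have : s <= s ^+ 2 by rewrite expr2 ler_peMr// (le_trans ler01 s1).
by rewrite {1}/s; lra.
Qed.

(* Along the segment from x0 to an interior point x1, monotonicity against g0
   and an upper bound on f around x1 keep the subgradients of f bounded. Bounded
   sums then keep those of r bounded, and they cluster at a subgradient at x0. *)
Lemma subdiff_of_bounded_sums X rho eta f r x0 x1 g0 (B : R) :
  convex_set X -> 0 <= rho -> 0 <= eta ->
  lsc_on X f -> lsc_on X r -> weakly_convex X rho f -> weakly_convex X eta r ->
  X x0 -> nbhs x1 X -> subdiff X rho f x0 g0 ->
  (forall (t : R) g h, 0 <= t <= 1 -> subdiff X rho f (x0 + t *: (x1 - x0)) g ->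
    subdiff X eta r (x0 + t *: (x1 - x0)) h -> enorm (g + h) <= B) ->
  subdiff X eta r x0 !=set0.
Proof.
move=> cX rho0 eta0 lf lr wf wr Xx0 /nbhs_enormP[s s0 sX] /subdiffP Hg0 HB.
pose D := x1 - x0.
have Xx1 : X x1 by apply: sX; rewrite subrr enorm0 ltW.
pose t n : R := n.+1%:R^-1.
have t0 n : 0 < t n by rewrite invr_gt0.
have t1 n : t n <= 1 by rewrite invf_le1 ?ler1n.
have t01 n : 0 <= t n <= 1 by rewrite t1 ltW.
pose p n := x0 + t n *: D.
have Xp n : X (p n) by apply: convex_set_segment.
(* Contracting the ball around [x1] towards [x0] by the factor [t n] gives a ball around [p n]
   inside [X]. *)
have nXp n : nbhs (p n) X.
  apply/nbhs_enormP; exists (t n * s) => [|y yp]; first by rewrite mulr_gt0.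
  pose y1 := x1 + (t n)^-1 *: (y - p n).
  have -> : y = x0 + t n *: (y1 - x0).
    rewrite /y1 addrAC scalerDr scalerA divff ?gt_eqF// scale1r.
    by rewrite addrA addrC subrK.
  apply: convex_set_segment => //; apply: sX; rewrite /y1 addrC addKr.
  rewrite -ler_sqr ?nnegrE ?enorm_ge0 ?(ltW s0)// enormZ_sqr exprVn.
  rewrite mulrC ler_pdivrMr ?exprn_gt0// -exprMn mulrC.
  by rewrite ler_sqr ?nnegrE ?enorm_ge0// mulr_ge0 ?ltW.
have /choice[g Hg] (n : nat) : exists g, subdiff X rho f (p n) g.
  exact: subdiff_interior.
have /choice[h Hh] (n : nat) : exists h, subdiff X eta r (p n) h.
  exact: subdiff_interior.
pose b i := `|f (x1 + s *: delta_mx ord0 i)| + `|f (x1 - s *: delta_mx ord0 i)|.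
pose M := (\sum_i b i + `|f x0| + `|dot g0 D| +
  rho * (3 * enorm D ^+ 2 + s ^+ 2)) / s.
have bM i : b i <= \sum_j b j.
  by rewrite (bigD1 i)//= lerDl sumr_ge0// => j _; rewrite addr_ge0.
have gM n i : `|g n ord0 i| <= M.
  have /subdiffP Hgn := Hg n.
  have eD : enorm (x0 - p n) ^+ 2 = t n ^+ 2 * enorm D ^+ 2.
    by rewrite enorm_subC /p addrC addKr enormZ_sqr.
  have up := Hg0 _ (Xp n); have dn := Hgn _ Xx0.
  rewrite enorm_subC eD in up; rewrite eD in dn.
  have e0 : p n - x0 = t n *: D by rewrite /p addrC addKr.
  rewrite e0 dotZr in up; rewrite -(opprB (p n) x0) e0 dotNr dotZr in dn.
  have ND := sqr_ge0 (enorm D).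
  (* Weak monotonicity: the inequalities of [g0] at [p n] and of [g n] at [x0] are added and divided
     by [t n]. *)
  have slope : dot g0 D - rho * (t n * enorm D ^+ 2) <= dot (g n) D.
    rewrite -(ler_pM2l (t0 n)); lra.
  have probe (c : R) : c ^+ 2 = 1 -> c * s * g n ord0 i <=
      f (x1 + (c * s) *: delta_mx ord0 i) + `|f x0| + `|dot g0 D| +
      rho * (3 * enorm D ^+ 2 + s ^+ 2).
    move=> c1; set z := x1 + _.
    have ez : enorm (z - x1) ^+ 2 = s ^+ 2.
      by rewrite /z addrC addKr enormZ_sqr enorm_delta exprMn c1 mulr1 mul1r.
    have Xz : X z.
      by apply: sX; rewrite -ler_sqr ?nnegrE ?enorm_ge0 ?(ltW s0)// ez.
    (* The first part isolates one coordinate of [g n]; the second is controlled from below by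
       [slope]. *)
    have zp : z - p n = (c * s) *: delta_mx ord0 i + (1 - t n) *: D.
      rewrite /z /p opprD addrA scalerBl scale1r addrA; congr (_ - _).
      by rewrite /D addrA; congr (_ - _); rewrite addrC.
    have := Hgn _ Xz; rewrite zp dotDr !dotZr dot_delta.
    have := enormD_sqr_le ((c * s) *: delta_mx ord0 i) ((1 - t n) *: D).
    rewrite !enormZ_sqr enorm_delta exprMn c1 mul1r mulr1.
    move: (enorm (_ + _) ^+ 2) => E hE hz.
    have := t1 n; have := t0 n; move: (t n) up dn slope hE hz => w.
    move=> up dn slope hE hz w0 w1.
    have a1 := ler_norm (- f x0); have a2 := ler_norm (- dot g0 D).
    rewrite normrN in a1; rewrite normrN in a2.
    have q1 : rho * E <= rho * (2 * s ^+ 2 + 2 * ((1 - w) ^+ 2 * enorm D ^+ 2)).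
      by rewrite ler_wpM2l.
    have q2 : (1 - w) * (dot g0 D - rho * (w * enorm D ^+ 2)) <=
        (1 - w) * dot (g n) D by rewrite ler_wpM2l// subr_ge0.
    have rN : 0 <= rho * enorm D ^+ 2 by rewrite mulr_ge0.
    have q3 : w ^+ 2 * (rho * enorm D ^+ 2) <= 1 * (rho * enorm D ^+ 2).
      by rewrite ler_wpM2r// expr_le1// ltW.
    have q4 : (1 - w) ^+ 2 * (rho * enorm D ^+ 2) <= 1 * (rho * enorm D ^+ 2).
      by rewrite ler_wpM2r// expr_le1// ?subr_ge0// gerBl ltW.
    have q5 : (1 - w) * w * (rho * enorm D ^+ 2) <= 1 * (rho * enorm D ^+ 2).
      by rewrite ler_wpM2r//; nra.
    by lra.
  have pp := probe 1 (expr1n _ _).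
  have pm : (-1) ^+ 2 = 1 :> R by rewrite sqrrN expr1n.
  have {probe}pm := probe _ pm; rewrite mulN1r scaleNr !mul1r in pp pm.
  have bMi := bM i; rewrite /b in bMi.
  have l1 := ler_norm (f (x1 + s *: delta_mx ord0 i)).
  have l2 := ler_norm (f (x1 - s *: delta_mx ord0 i)).
  have l1' := normr_ge0 (f (x1 + s *: delta_mx ord0 i)).
  have l2' := normr_ge0 (f (x1 - s *: delta_mx ord0 i)).
  by rewrite ler_norml lerNl /M !ler_pdivlMr//; apply/andP; split; lra.
have hC n : enorm (h n) ^+ 2 <= 2 * B ^+ 2 + 2 * (d%:R * M ^+ 2).
  have := enormD_sqr_le (g n + h n) (- g n).
  rewrite addrAC subrr add0r -sub0r enorm_subC subr0.
  have := dot_le_coord (gM n); rewrite -enorm_sqr.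
  have gh := HB _ _ _ (t01 n) (Hg n) (Hh n).
  have : enorm (g n + h n) ^+ 2 <= B ^+ 2.
    by rewrite ler_sqr ?nnegrE ?enorm_ge0// (le_trans _ gh)// enorm_ge0.
  by lra.
have [U [UU sU]] := ultraFilterLemma eventually_filter.
have [l hl] := cvg_ultra_bounded UU hC.
exists l; apply: (@subdiff_cvg _ _ _ U X eta r p h x0 l) => //.
have pr n : enorm (p n - x0) ^+ 2 <= enorm D ^+ 2 / n.+1%:R.
  rewrite /p addrC addKr enormZ_sqr mulrC ler_wpM2l ?sqr_ge0// expr2.
  by rewrite ler_piMl// ltW.
exact: (cvg_trans (cvg_app p sU) (cvg_enorm_rate pr)).
Qed.

End BoundedSums.

(** * Constant step sizes *)

Section ConstantStep.
Context {R : realType} {d : nat}.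
Implicit Types (X : set 'rV[R]_d) (f r : 'rV[R]_d -> R).

(** For [b = 0] the quotient is infinite and the right side reduces to [0 < a], so both sides
    hold. *)
Lemma lt_xfrac (a b c : R) : 0 < a -> 0 <= b ->
  (c%:E < xfrac a b)%E = (c * b < a).
Proof.
move=> a0; rewrite le_eqVlt => /predU1P[<-|b0].
  by rewrite mulr0 a0 /xfrac inve0 gt0_muley ?lte_fin// ltry.
by rewrite /xfrac inver gt_eqF// -EFinM lte_fin ltr_pdivlMr.
Qed.

Lemma le_sqrD1 (a : R) : a <= a ^+ 2 + 1.
Proof. by nra. Qed.

Lemma constant_step_bounded_rate X rho eta f r (x g : nat -> 'rV[R]_d) alpha
    (kappa a C : R) :
  let phi := f \+ r in let S := argmin_on X phi in
  closed X -> convex_set X -> lsc_on X f -> lsc_on X r -> S !=set0 ->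
  0 <= rho -> 0 <= eta -> weakly_convex X rho f -> weakly_convex X eta r ->
  prox_subgrad X rho f r x g alpha -> (forall k, alpha k = a%:E) ->
  0 < kappa -> global_quadratic_growth X phi kappa -> 0 <= C ->
  kappa * (rho + 2 * eta) < 2 -> 0 < a ->
  a * (2 * C * kappa) < 2 - kappa * (rho + 2 * eta) -> a * (6 * eta) < 1 ->
  (forall y u v, X y -> subdiff X rho f y u -> subdiff X eta r y v ->
     enorm (u + v) ^+ 2 <= C * dist y S ^+ 2) ->
  exists mu : R, [/\ 0 < mu, mu < 1 &
    forall k, dist (x k.+1) S ^+ 2 <= mu * dist (x k) S ^+ 2].
Proof.
move=> phi S clX cX lf lr S0 rho0 eta0 wf wr pr alphaE k0 qg C0 k2 a0 aC a6 bnd.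
have Xx k : X (x k) := prox_subgrad_feasible k pr.
apply: (constant_step_linear_rate cX S0 rho0 eta0 wr pr alphaE k0 qg C0 k2 a0 aC a6).
have hS k : subdiff X eta r (x k.+1) !=set0.
  have [_] := pr.2 k; rewrite alphaE => st.
  by eexists; exact: (prox_step_subdiff cX wr a0 st).
suff h0 : subdiff X eta r (x 0%N) !=set0.
  move=> k; have [h Hh] : subdiff X eta r (x k) !=set0 by case: k.
  by exists h => //; apply: bnd => //; exact: (pr.2 k).1.
have [p Sp] := S0.
have [h1 Hh1] := hS 0%N.
(* A fixed minimizer [p] replaces the distance, giving a bound that is easily made uniform on the
   segment from [x 0] to [x 1]. *)
have bnd_seg y u v : X y -> subdiff X rho f y u -> subdiff X eta r y v ->
    enorm (u + v) <= C * enorm (y - p) ^+ 2 + 1.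
  move=> Xy Hu Hv; apply: (le_trans (le_sqrD1 _)); rewrite lerD2r.
  apply: (le_trans (bnd _ _ _ Xy Hu Hv)); rewrite ler_wpM2l//.
  by rewrite ler_sqr ?nnegrE ?dist_ge0 ?enorm_ge0// dist_le.
have nx1 : nbhs (x 1%N) X.
  apply: (bounded_sums_interior clX cX (Xx _) (pr.2 1%N).1 Hh1) => g' Hg'.
  exact: (bnd_seg _ _ _ (Xx 1%N) Hg' Hh1).
apply: (subdiff_of_bounded_sums
  (B := C * (2 * enorm (x 0%N - p) ^+ 2 + 2 * enorm (x 1%N - x 0%N) ^+ 2) + 1)
  cX rho0 eta0 lf lr wf wr (Xx _) nx1 (pr.2 0%N).1).
move=> t u v t01 Hu Hv.
have Xt := convex_set_segment cX (Xx 0%N) (Xx 1%N) t01.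
apply: (le_trans (bnd_seg _ _ _ Xt Hu Hv)); rewrite lerD2r ler_wpM2l//.
rewrite addrAC (le_trans (enormD_sqr_le _ _))// lerD2l ler_wpM2l// enormZ_sqr.
case/andP: t01 => t0 t1; rewrite ler_piMl ?sqr_ge0// expr_le1//.
Qed.

(* Weak convexity and (B_G) bound the gap by the squared distance, so that (B_G)
   implies a bound of the type (B_A-D). *)
Lemma gap_le_dist_sqr X rho eta f r (x g h : 'rV[R]_d) (c : R) :
  let phi := f \+ r in let S := argmin_on X phi in
  S !=set0 -> 0 <= rho -> 0 <= eta -> 0 <= c -> X x ->
  subdiff X rho f x g -> subdiff X eta r x h ->
  enorm (g + h) ^+ 2 <= c * (phi x - minval X phi) ->
  phi x - minval X phi <= (rho + eta + c) * dist x S ^+ 2.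
Proof.
move=> phi S S0 rho0 eta0 c0 Xx Hg Hh.
have D0 : 0 <= phi x - minval X phi by rewrite subr_ge0 minval_le.
set Delta := phi x - _ in D0 * => hc; rewrite -[leRHS]addr0.
apply: le_dist_sqr => // [|p Sp]; first by rewrite !addr_ge0.
have : Delta <= enorm (g + h) * enorm (x - p) + (rho + eta) / 2 * enorm (x - p) ^+ 2.
  by rewrite /Delta (minval_argmin Sp); exact: weakly_convex_gap Sp.1 Hg Hh.
move: hc (enorm_ge0 (g + h)) (enorm_ge0 (x - p)).
move: (enorm (g + h)) (enorm (x - p)) => V P hc V0 P0 hD.
have s0 : 0 <= (rho + eta) * P ^+ 2 by rewrite mulr_ge0 ?sqr_ge0// addr_ge0.
(* From 2 c V P <= V^2 + c^2 P^2 and V^2 <= c Delta, divided by c; for c = 0 the bound forces V =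
   0. *)
have VP : 2 * (V * P) <= Delta + c * P ^+ 2.
  move: c0; rewrite le_eqVlt => /predU1P[c0|c0].
    have : V ^+ 2 == 0 by rewrite eq_le sqr_ge0 andbT (le_trans hc)// -c0 mul0r.
    by rewrite sqrf_eq0 => /eqP ->; rewrite mul0r mulr0 -c0 mul0r addr0.
  rewrite -(ler_pM2l c0); have := sqr_ge0 (V - c * P); nra.
by lra.
Qed.

End ConstantStep.

(** * Reduction of the four cases to the rates for constant and Polyak steps *)

Theorem theorem4p4 (R : realType) (d : nat) (X : set 'rV[R]_d)
    (f r : 'rV[R]_d -> R) (rho eta : R)
    (x g : nat -> 'rV[R]_d) (alpha : nat -> \bar R) :
  let phi := f \+ r in
  let Xstar := argmin_on X phi in
  closed X -> convex_set X ->
  lsc_on X f -> lsc_on X r ->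
  Xstar !=set0 ->
  0 <= rho -> 0 <= eta ->
  weakly_convex X rho f -> weakly_convex X eta r ->
  prox_subgrad X rho f r x g alpha ->
  (* (i) *)
  (exists kappa : R,
     [/\ 0 < kappa,
         global_quadratic_growth X phi kappa &
         [\/ (* (1) *)
             (kappa%:E < xfrac 2 (rho + 2 * eta))%E /\
             exists c9 a : R,
               [/\ cond_BAD X rho eta f r c9 0,
                   0 < a,
                   (a%:E < Order.min
                      (xfrac (2 - kappa * (rho + 2 * eta)) (2 * c9 ^+ 2 * kappa))
                      (xfrac 1 (6 * eta)))%E &
                   forall k, alpha k = a%:E],
             (* (2) *)
             (kappa%:E < xfrac 2 (rho + 2 * eta))%E /\
             exists c11 a : R,
               [/\ cond_BG X rho eta f r c11 0,
                   0 < a,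
                   (a%:E < Order.min
                      (xfrac (2 - kappa * (rho + 2 * eta))
                             (2 * c11 * (rho + eta + c11) * kappa))
                      (xfrac 1 (6 * eta)))%E &
                   forall k, alpha k = a%:E] |
             (* (3) *)
             [/\ (kappa%:E < xfrac 1 rho)%E,
                 eta = 0,
                 polyak_steps X eta f r x g alpha,
                 exists kappas gamma : R,
                   [/\ 0 < kappas, 0 < gamma & sharp_on_tube X phi gamma kappas] &
                 cond_B6 X rho eta f r (tube X phi (dist (x 0%N) Xstar + 1))]]])
  \/
  (* (ii) *)
  (exists kappas gamma : R,
     [/\ eta = 0,
         0 < kappas,
         0 < gamma /\ (gamma%:E < xfrac 1 (rho * kappas))%E,
         sharp_on_tube X phi gamma kappas &
         [/\ cond_B6 X rho eta f r (tube X phi gamma),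
             tube X phi gamma (x 0%N) &
             polyak_steps X eta f r x g alpha]]) ->
  exists mu : R, [/\ 0 < mu, mu < 1 &
    forall k, dist (x k.+1) Xstar ^+ 2 <= mu * dist (x k) Xstar ^+ 2].
Proof.
move=> phi Xstar clX cX lf lr S0 rho0 eta0 wf wr pr [].
  move=> [kappa [k0 qg H]].
  have re0 : 0 <= rho + 2 * eta by rewrite addr_ge0 ?mulr_ge0.
  case: H => [[]|[]|[]].
  - rewrite lt_xfrac// => k2 [c9 [a [[c90 _ bnd] a0]]].
    have num0 : 0 < 2 - kappa * (rho + 2 * eta) by rewrite subr_gt0.
    have e6 : 0 <= 6 * eta by rewrite mulr_ge0.
    rewrite lt_min !lt_xfrac//; last first.
      by rewrite !mulr_ge0 ?sqr_ge0// ltW.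
    move=> /andP[aC a6] aE.
    apply: (constant_step_bounded_rate (C := c9 ^+ 2) clX cX lf lr S0 rho0 eta0
      wf wr pr aE k0 qg (sqr_ge0 _) k2 a0 aC a6).
    move=> y u v Xy Hu Hv; have := bnd y u v Xy Hu Hv; rewrite addr0 => h.
    by rewrite -exprMn ler_sqr ?nnegrE ?enorm_ge0// mulr_ge0// dist_ge0.
  - rewrite lt_xfrac// => k2 [c11 [a [[c110 _ bnd] a0]]].
    have num0 : 0 < 2 - kappa * (rho + 2 * eta) by rewrite subr_gt0.
    have e6 : 0 <= 6 * eta by rewrite mulr_ge0.
    (* This is the constant [C]: (B_G) gives the factor [c11] on the gap, and the gap is at most
       [rho + eta + c11] times the squared distance. *)
    have C0 : 0 <= c11 * (rho + eta + c11) by rewrite mulr_ge0 ?addr_ge0.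
    rewrite lt_min !lt_xfrac//; last first.
      by rewrite -(mulrA 2) mulr_ge0 ?(ltW k0)// mulr_ge0.
    rewrite -(mulrA 2) => /andP[aC a6] aE.
    apply: (constant_step_bounded_rate clX cX lf lr S0 rho0 eta0
      wf wr pr aE k0 qg C0 k2 a0 aC a6).
    move=> y u v Xy Hu Hv; have := bnd y u v Xy Hu Hv; rewrite addr0 => h.
    have D0 : 0 <= phi y - minval X phi by rewrite subr_ge0 minval_le.
    have {}h : enorm (u + v) ^+ 2 <= c11 * (phi y - minval X phi).
      rewrite -[leRHS]sqr_sqrtr ?mulr_ge0//.
      by rewrite ler_sqr ?nnegrE ?enorm_ge0 ?sqrtr_ge0.
    rewrite -mulrA (le_trans h)// ler_wpM2l//.
    exact: gap_le_dist_sqr Hu Hv h.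
  - rewrite lt_xfrac// => krho eta_0; rewrite {}eta_0 in wr *.
    move=> [h Hh] [ks [gamma [ks0 gamma0 sharp]]] [c8 c80 bnd].
    (* Sharpness holds with [ks] closer than [gamma]; farther away, growth gives gamma dist <=
       dist^2 <= kappa gap, hence sharpness with [kappa / gamma]. The sum serves both regions. *)
    apply: (polyak_linear_rate (h := h) (L := dist (x 0%N) Xstar + 1)
      (K := ks + kappa / gamma) cX S0 rho0 wr pr Hh _ c80) => //.
    + by rewrite addr_gt0// divr_gt0.
    + by rewrite ltrDl.
    + move=> y [Xy _]; apply: (le_trans (ler_wpM2l rho0 (qg _ Xy))).
      have : 0 <= phi y - minval X phi by rewrite subr_ge0 minval_le.
      by rewrite mulrA (mulrC rho) => D0; rewrite ler_piMl// ltW.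
    + move=> y [Xy _].
      have D0 : 0 <= phi y - minval X phi by rewrite subr_ge0 minval_le.
      rewrite mulrDl; have [yg|yg] := ltP (dist y Xstar) gamma.
        apply: (le_trans (sharp y (conj Xy yg))); rewrite lerDl.
        by rewrite mulr_ge0// divr_ge0 ?ltW.
      have : dist y Xstar <= kappa / gamma * (phi y - minval X phi).
        rewrite mulrAC ler_pdivlMr// (le_trans _ (qg _ Xy))// expr2.
        by rewrite ler_wpM2l// dist_ge0.
      by move/le_trans; apply; rewrite lerDr mulr_ge0// ltW.
move=> [ks [gamma [eta_0 ks0 [gamma0 gk] sharp [[c8 c80 bnd] [Xx0 x0g]]]]].
rewrite {}eta_0 in wr bnd * => -[h Hh].
move: gk; rewrite lt_xfrac ?mulr_ge0 ?(ltW ks0)// => gk.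
apply: (polyak_linear_rate (h := h) (L := gamma) cX S0 rho0 wr pr Hh ks0 c80) => //.
move=> y ty; have := sharp y ty; have [Xy yg] := ty.
have := @dist_ge0 _ _ y _ S0; rewrite -/phi -/Xstar.
have D0 : 0 <= phi y - minval X phi by rewrite subr_ge0 minval_le.
move: (dist y Xstar) (phi y - _) yg D0 => D Delta Dg D0 Dp DK.
(* One factor of [D ^+ 2] is bounded by the tube radius, the other by sharpness;
   [gamma * (rho * ks) < 1] then makes the gap dominate the weak convexity term. *)
have h1 : rho * D ^+ 2 <= rho * (gamma * (ks * Delta)).
  by rewrite ler_wpM2l// expr2 ler_pM// ltW.
apply: (le_trans h1).
have -> : rho * (gamma * (ks * Delta)) = gamma * (rho * ks) * Delta by ring.
by rewrite ler_piMl// ltW.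
Qed.
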